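(* Let $T$ be a skew tract endowed with an involution $x\mapsto\overline x$, let $N$ be a matroid on a non-empty finite set $E$, let $\mathcal{C}$ be a left $T$-signature of $N$, and let $\mathcal{D}$ be a right $T$-signature of $N^*$. Then $\mathcal{C}$ and $\mathcal{D}$ are the sets of $T$-circuits and $T$-cocircuits, respectively, of a strong left $T$-matroid with underlying matroid $N$ if and only if $(\mathcal{C},\mathcal{D})$ forms a dual pair of $T$-signatures of $N$, i.e. $\mathcal{C}\perp\mathcal{D}$.
   Context: **Skew tracts.** A skew tract $T$ is a group $G$ (written multiplicatively, identity $1$) together with a subset $N_G$ of the group semiring $\mathbb{N}[G]$ such that: (1) $0\in N_G$; (2) $1\notin N_G$; (3) there is a unique $\epsilon\in G$ with $1+\epsilon\in N_G$; (4) $N_G$ is closed under the left and right actions of $G$ on $\mathbb{N}[G]$. Write $T=G\cup\{0\}$, $T^\times=G$, where $0$ is identified with the zero of $\mathbb{N}[G]$ and is absorbing for multiplication; $-x:=\epsilon x$ (one has $\epsilon x=x\epsilon$ and $\epsilon^2=1$). An involution of $T$ is a map $x\mapsto\overline x$ from $T$ to $T$ with $\overline 0=0$, that is a monoid homomorphism $(T,\cdot,1)\to(T,\cdot,1)$, preserves addition (its additive extension to $\mathbb{N}[G]$ maps $N_G$ into $N_G$), and has square the identity. $T^E$ is the set of functions $E\to T$, with coordinatewise left and right multiplication by $T$. The support of $X\in T^E$ is $\underline{X}=\{e\in E: X(e)\neq 0\}$; for $S\subseteq T^E$, $\underline{S}$ is the set of supports of elements of $S$. **Orthogonality.** $X\perp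 Y$ means $X\cdot Y:=\sum_{e\in E}X(e)\overline{Y(e)}\in N_G$; $\mathcal{C}\perp\mathcal{D}$ means $X\perp Y$ for all $X\in\mathcal{C}$, $Y\in\mathcal{D}$. **Modular families.** For a collection $C$ of pairwise incomparable non-empty subsets of $E$, $U(C)=\{\bigcup S: S\subseteq C\}$ is a lattice under inclusion (join is union, minimal element $\emptyset$). A family of members of $C$ is modular if the height of its union in $U(C)$ equals the size of the family. A family of elements of $\mathcal{C}\subseteq T^E$ is modular if the family of supports is modular in $\underline{\mathcal{C}}$. **Strong $T$-matroids.** $\mathcal{C}\subseteq T^E$ is the $T$-circuit set of a strong left $T$-matroid $\mathcal{M}=(E,\mathcal{C})$ on $E$ if: (C1) $0\notin\mathcal{C}$; (C2) $X\in\mathcal{C}$, $\alpha\in T^\times$ imply $\alpha X\in\mathcal{C}$; (C3) if $X,Y\in\mathcal{C}$ and $\underline X\subseteq\underline Y$ then $Y=\alpha X$ for some $\alpha\in T^\times$; (C4)$'$ whenever $X_1,\dots,X_k,X\in\mathcal{C}$ together form a modular family of size $k+1$ with $\underline X\not\subseteq\bigcup_{i}\underline{X_i}$, and $e_i\in(\underline X\cap\underline{X_i})\setminus\bigcup_{j\ne i}\underline{X_j}$ satisfy $X(e_i)=-X_i(e_i)\neq0$ for $1\le i\le k$, there is $Z\in\mathcal{C}$ with $Z(e_i)=0$ for $1\le i\le k$ and $X(f)+X_1(f)+\dots+X_k(f)-Z(f)\in N_G$ for every $f\in E$. The underlying matroid $\underline{\mathcal{M}}$ is the matroid on $E$ whose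 circuits are the supports of the elements of $\mathcal{C}$. **Signatures.** A left $T$-signature of a matroid $N$ is a set $\mathcal{C}\subseteq T^E$ satisfying (C1), (C2), (C3) such that $\underline{\mathcal{C}}$ is the set of circuits of $N$. Right $T$-signatures are defined likewise with $X\alpha$ in place of $\alpha X$ in (C2), (C3). $(\mathcal{C},\mathcal{D})$ is a dual pair of $T$-signatures of $N$ if $\mathcal{C}$ is a left $T$-signature of $N$, $\mathcal{D}$ is a right $T$-signature of the dual matroid $N^*$, and $\mathcal{C}\perp\mathcal{D}$. **Cocircuits.** $A_N$ is the set of ordered pairs $(B,B')$ of bases of $N$ with $|B\setminus B'|=1$; $Fab=F\cup\{a,b\}$ etc. For a left $T$-matroid $\mathcal{M}$ with $T$-circuit set $\mathcal{C}$ and underlying matroid $N$, let $[Fa,Fb]_{\mathcal{C}}:=-X(a)^{-1}X(b)$ for any $X\in\mathcal{C}$ with $a,b\in\underline X\subseteq Fab$ (well defined on $A_N$), and let $[B,B']^*:=-\overline{[E\setminus B,E\setminus B']_{\mathcal{C}}}$ for $(B,B')\in A_{N^*}$. The set of $T$-cocircuits of $\mathcal{M}$ is the $T$-circuit set of the dual right $T$-matroid $\mathcal{M}^*$ (the one with quasi-Plücker coordinates $[\cdot]^*$), namely $\{Y\in T^E:\underline Y$ is a circuit of $N^*$ and $Y(b)Y(a)^{-1}=-[Fa,Fb]^*$ whenever $a,b\in\underline Y\subseteq Fab$ with $(Fa,Fb)\in A_{N^*}\}$. *)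

(* Defs.v *)
From HB Require Import structures.
From mathcomp Require Import all_boot ssralg.

Set Implicit Arguments.
Unset Strict Implicit.
Unset Printing Implicit Defensive.

Section Matroids.
Variable E : finType.
Implicit Types B C S : {set E}.

Record matroid : Type := Matroid {
  bases : {set {set E}};
  bases_neq0 : bases != set0;
  bases_exchange : forall B B' x, B \in bases -> B' \in bases ->
    x \in B :\: B' -> exists2 y, y \in B' :\: B & y |: (B :\ x) \in bases
}.

Definition indep (N : matroid) S : bool := [exists B in bases N, S \subset B].

Definition circuits (N : matroid) : {set {set E}} :=
  [set C : {set E} | minset (fun S => ~~ indep N S) C]%SET.

Lemma bases_leq (N : matroid) B B' :
  B \in bases N -> B' \in bases N -> #|B| <= #|B'|.
Proof.
have [n] := ubnP #|B :\: B'|; elim: n B => // n IH B; rewrite ltnS => ltn BN B'N.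
have [/eqP|[x xBB']] := set_0Vmem (B :\: B').
  by rewrite setD_eq0 => /subset_leq_card.
have [y yB'B yBx] := bases_exchange BN B'N xBB'.
move: (xBB') (yB'B); rewrite !inE => /andP[xB' xB] /andP[yB yB'].
have -> : #|B| = #|y |: B :\ x|.
  by rewrite cardsU1 !inE (negPf yB) andbF (cardsD1 x B) xB.
apply: IH => //; apply: leq_trans ltn.
apply: proper_card; apply/properP; split.
  apply/subsetP => z; rewrite !inE => /andP[zB'] /orP[/eqP zy|/andP[_ zB]].
    by rewrite zy yB' in zB'.
  by rewrite zB' zB.
exists x => //; rewrite !inE eqxx xB' /= orbF.
by apply: contraNneq yB => <-.
Qed.

Lemma bases_coexchange (N : matroid) B1 B2 x :
  B1 \in bases N -> B2 \in bases N -> x \in B2 :\: B1 ->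
  exists2 y, y \in B1 :\: B2 & x |: (B1 :\ y) \in bases N.
Proof.
move=> B1N B2N xB21.
pose P B := [&& B \in bases N, x |: (B1 :&: B2) \subset B & B \subset B1 :|: B2].
move: (xB21); rewrite !inE => /andP[xB1 xB2].
have P2 : P B2.
  by rewrite /P B2N subsetUr andbT subUset sub1set xB2 subsetIr.
case: (@arg_maxnP _ B2 P (fun B => #|B :&: B1|) P2) => B /and3P[BN sB Bs] maxB.
have xB : x \in B by move: sB; rewrite subUset sub1set => /andP[].
have sBx : B \subset x |: B1.
  apply/subsetP => z zB; rewrite !inE; apply/negPn/negP.
  rewrite negb_or => /andP[zx zB1].
  have zBB1 : z \in B :\: B1 by rewrite !inE zB1.
  have [w wB1B wN] := bases_exchange BN B1N zBB1.
  move: wB1B; rewrite !inE => /andP[wB wB1].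
  have PB' : P (w |: B :\ z).
    rewrite /P wN /=; apply/andP; split; apply/subsetP => u.
      move=> uI; move: (subsetP sB u uI) => uB; rewrite !inE uB andbT.
      suff -> : u != z by rewrite orbT.
      move: uI; rewrite !inE => /orP[/eqP ->|/andP[uB1 _]]; first by rewrite eq_sym.
      by apply: contraNneq zB1 => <-.
    rewrite !inE => /orP[/eqP ->|/andP[_ uB]]; first by rewrite wB1.
    by move: (subsetP Bs u uB); rewrite inE.
  have := maxB _ PB'; apply/negP; rewrite -ltnNge.
  apply: proper_card; apply/properP; split.
    apply/subsetP => u; rewrite !inE => /andP[uB uB1].
    rewrite uB uB1 !andbT; suff -> : u != z by rewrite orbT.
    by apply: contraNneq zB1 => <-.
  by exists w; rewrite !inE ?eqxx ?wB1 // (negPf wB).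
have cB : #|B| = #|B1| by apply/eqP; rewrite eqn_leq !(@bases_leq N).
have [y yB1 yB] : exists2 y, y \in B1 & y \notin B.
  apply/subsetPn; apply: contraNN xB1 => sB1.
  have /eqP -> : B1 == B by rewrite eqEcard sB1 cB leqnn.
  exact: xB.
exists y.
  rewrite inE yB1 andbT; apply: contraNN yB => yB2.
  by apply: (subsetP sB); rewrite !inE yB1 yB2 orbT.
suff -> : x |: B1 :\ y = B by [].
apply/esym/eqP; rewrite eqEcard; apply/andP; split.
  apply/subsetP => u uB; move: (subsetP sBx u uB); rewrite !inE.
  case/orP => [->//|uB1]; rewrite uB1 andbT orbC.
  by rewrite (_ : u != y) //; apply: contraNneq yB => <-.
by rewrite cardsU1 !inE (negPf xB1) andbF cB (cardsD1 y B1) yB1.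
Qed.

Definition dual_bases (N : matroid) : {set {set E}} :=
  [set B : {set E} | ~: B \in bases N]%SET.

Fact dual_bases_neq0 (N : matroid) : dual_bases N != set0.
Proof.
have /set0Pn[B BN] := bases_neq0 N.
by apply/set0Pn; exists (~: B); rewrite inE setCK.
Qed.

Fact dual_bases_exchange (N : matroid) B B' x :
  B \in dual_bases N -> B' \in dual_bases N -> x \in B :\: B' ->
  exists2 y, y \in B' :\: B & y |: (B :\ x) \in dual_bases N.
Proof.
rewrite !inE => BN B'N /andP[xB' xB].
have [|y] := bases_coexchange (x := x) BN B'N; first by rewrite !inE xB xB'.
rewrite !inE negbK => /andP[yB' yB] yN.
exists y; rewrite ?inE ?yB' ?yB //.
suff -> : ~: (y |: B :\ x) = x |: ~: B :\ y by [].
apply/setP => u; rewrite !inE negb_or negb_and negbK.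
have [->|ux] /= := eqVneq u x; last by [].
by rewrite andbT; apply: contraNneq yB => <-.
Qed.

Definition dual (N : matroid) : matroid :=
  Matroid (dual_bases_neq0 N) (@dual_bases_exchange N).

Definition adjacent_bases (N : matroid) : {set {set E} * {set E}} :=
  [set p : {set E} * {set E} |
    [&& p.1 \in bases N, p.2 \in bases N & #|p.1 :\: p.2| == 1]]%SET.

Definition union_lattice (C : {set {set E}}) : {set {set E}} :=
  [set (\bigcup_(A in S) A)%SET | S : {set {set E}} in powerset C]%SET.

Definition is_chain (K : {set {set E}}) : bool :=
  [forall A in K, forall B in K, (A \subset B) || (B \subset A)].

(** Height of A in the lattice U(C): the maximal length #|K| - 1 of a chain K from the
    minimal element to A. *)
Definition height (C : {set {set E}}) (A : {set E}) : nat :=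
  \max_(K : {set {set E}} |
      [&& K \subset union_lattice C, is_chain K, set0 \in K, A \in K
        & [forall B in K, B \subset A]])
    #|K|.-1.

Definition modular_family (C : {set {set E}}) (I : finType) (F : I -> {set E}) :=
  [/\ forall i, F i \in C & height C (\bigcup_i F i)%SET = #|I|].

End Matroids.

From mathcomp Require Import finmap multiset.
From mathcomp Require Import boolp classical_sets.

(** The group semiring N[G]: finitely supported functions G -> nat, i.e. finite
    multisets on G.  Only its additive structure and the two actions of G are
    needed; the actions are linear extensions of translations. *)

Definition group_semiring (G : groupType) : Type := {mset G}%mset.

HB.instance Definition _ (G : groupType) := Choice.copy (group_semiring G)
  {mset G}%mset.
HB.instance Definition _ (G : groupType) :=
  GRing.isNmodule.Build (group_semiring G)
    (@msetDA G) (@msetDC G) (@mset0D G).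

Definition gsingle (G : groupType) (g : G) : group_semiring G := msetn 1 g.

Definition linext (G : groupType) (f : G -> group_semiring G)
    (A : group_semiring G) : group_semiring G :=
  (\sum_(g <- enum_mset A) f g)%R.

Definition lact (G : groupType) (g : G) :=
  linext (fun h : G => gsingle (g * h)%g).

Definition ract (G : groupType) (g : G) :=
  linext (fun h : G => gsingle (h * g)%g).

Record skewTract : Type := SkewTract {
  units : groupType;
  null : set (group_semiring units);
  eps : units;
  null0 : null 0%R;
  null1 : ~ null (gsingle 1%g);
  null_eps : null (gsingle 1%g + gsingle eps)%R;
  eps_uniq : forall e : units,
    null (gsingle 1%g + gsingle e)%R -> e = eps;
  null_lact : forall (g : units) A, null A -> null (lact g A);
  null_ract : forall (g : units) A, null A -> null (ract g A)
}.

(** The set T = G \cup {0}, with 0 encoded as None. *)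
Definition tract_sort (T : skewTract) : Type := option (units T).
Coercion tract_sort : skewTract >-> Sortclass.

HB.instance Definition _ (T : skewTract) :=
  Choice.copy (tract_sort T) (option (units T)).

Section TractMonoid.
Variable T : skewTract.

Definition tzero : T := None.
Definition tunit (g : units T) : T := Some g.

Definition tmul (x y : T) : T :=
  match x, y with
  | Some g, Some h => tunit (g * h)%g
  | _, _ => tzero
  end.

Definition tinv (x : T) : T :=
  if x is Some g then tunit (g^-1)%g else tzero.

Fact tmulA : associative tmul.
Proof. by move=> [x|] [y|] [z|] //=; rewrite mulgA. Qed.
Fact tmul1 : left_id (tunit 1%g) tmul.
Proof. by move=> [x|] //=; rewrite mul1g. Qed.
Fact tmulr1 : right_id (tunit 1%g) tmul.
Proof. by move=> [x|] //=; rewrite mulg1. Qed.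

HB.instance Definition _ := isMonoid.Build (tract_sort T) tmulA tmul1 tmulr1.
HB.instance Definition _ := hasInv.Build (tract_sort T) tinv.

Definition topp (x : T) : T := (tunit (eps T) * x)%g.

(* T as a subset of N[G], with 0 in T identified with 0 in N[G] *)
Definition tinj (x : T) : group_semiring (units T) :=
  (if x is Some g then gsingle g else 0)%R.

(** conj is multiplicative, not anti-multiplicative; conj_null is stated for the
    additive extension of conj to N[G]. *)
Record involution : Type := Involution {
  conj :> T -> T;
  conj0 : conj tzero = tzero;
  conj_monoid : monoid_morphism conj;
  conj_null : forall A, null A -> null (linext (fun g => tinj (conj (tunit g))) A);
  conjK : involutive conj
}.

End TractMonoid.

Arguments tzero {T}.

Section Signatures.
Variables (T : skewTract) (E : finType).
Implicit Types (C D : set {ffun E -> T}) (X Y Z : {ffun E -> T}).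

Definition supp X : {set E} := [set e | X e != tzero]%SET.

Definition supports C : {set {set E}} :=
  [set S : {set E} | `[< exists2 X, C X & supp X = S >]]%SET.

Definition lscale (a : T) X : {ffun E -> T} := [ffun e => (a * X e)%g].
Definition rscale X (a : T) : {ffun E -> T} := [ffun e => (X e * a)%g].

Definition vec0 : {ffun E -> T} := [ffun=> tzero].

Definition C1 C := ~ C vec0.

Definition lC2 C := forall X (a : units T), C X -> C (lscale (tunit a) X).
Definition rC2 C := forall X (a : units T), C X -> C (rscale X (tunit a)).

Definition lC3 C := forall X Y, C X -> C Y -> supp X \subset supp Y ->
  exists a : units T, Y = lscale (tunit a) X.
Definition rC3 C := forall X Y, C X -> C Y -> supp X \subset supp Y ->
  exists a : units T, Y = rscale X (tunit a).

(* The family X_1, ..., X_k, X is indexed by option 'I_k, with X at None. *)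
Definition C4' C :=
  forall (k : nat) (Xs : 'I_k -> {ffun E -> T}) X (e : 'I_k -> E),
    (forall i, C (Xs i)) -> C X ->
    modular_family (supports C) (fun o : option 'I_k => supp (oapp Xs X o)) ->
    ~~ (supp X \subset \bigcup_(i < k) supp (Xs i))%SET ->
    (forall i, e i \in (supp X :&: supp (Xs i))
                         :\: (\bigcup_(j < k | j != i) supp (Xs j))%SET) ->
    (forall i, X (e i) = topp (Xs i (e i)) /\ topp (Xs i (e i)) <> tzero) ->
  exists Z, [/\ C Z, forall i, Z (e i) = tzero
    & forall f : E,
        null (tinj (X f) + \sum_(i < k) tinj (Xs i f) + tinj (topp (Z f)))%R].

Record strongMatroid : Type := StrongMatroid {
  tcircuits :> set {ffun E -> T};
  tcircuitsC1 : C1 tcircuits;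
  tcircuitsC2 : lC2 tcircuits;
  tcircuitsC3 : lC3 tcircuits;
  tcircuitsC4 : C4' tcircuits
}.

Definition underlying (M : strongMatroid) (N : matroid E) :=
  circuits N = supports M.

Definition left_signature (N : matroid E) C :=
  [/\ C1 C, lC2 C, lC3 C & supports C = circuits N].

Definition right_signature (N : matroid E) D :=
  [/\ C1 D, rC2 D, rC3 D & supports D = circuits N].

Variable bar : involution T.

Definition orthogonal X Y :=
  null (\sum_(e : E) tinj (X e * bar (Y e))%g)%R.

Definition dual_pair (N : matroid E) C D :=
  [/\ left_signature N C, right_signature (dual N) D
    & forall X Y, C X -> D Y -> orthogonal X Y].

(** [B, B']_C, meaningful for (B, B') in A_N: the common value of
    - X(a)^-1 X(b), where B = Fa and B' = Fb. *)
Definition qplucker C (B B' : {set E}) : T :=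
  xget tzero [set t : T | exists F a b X,
    [/\ B = a |: F, B' = b |: F, C X,
        [/\ a \in supp X, b \in supp X & supp X \subset a |: (b |: F)]
      & t = topp ((X a)^-1 * X b)%g]]%classic.

(** [B, B']^* , meaningful for (B, B') in A_(N^* ) *)
Definition qplucker_dual C (B B' : {set E}) : T :=
  topp (bar (qplucker C (~: B) (~: B'))).

(** T-cocircuits of the left T-matroid with T-circuit set C and underlying
    matroid N. *)
Definition tcocircuits (N : matroid E) C : set {ffun E -> T} :=
  [set Y | supp Y \in circuits (dual N) /\
    forall (F : {set E}) (a b : E),
      a \in supp Y -> b \in supp Y -> supp Y \subset a |: (b |: F) ->
      (a |: F, b |: F) \in adjacent_bases (dual N) ->
      (Y b * (Y a)^-1)%g = topp (qplucker_dual C (a |: F) (b |: F))]%classic.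

End Signatures.

(* Main.v *)
(** Let f, z, e_1, ..., e_k be elements such that X and a cocircuit Y meet only among them,
    let X_i be a circuit meeting Y in {e_i, f} with X_i(e_i) = - X(e_i), and Z one meeting Y
    in {z, f} with Z(z) = X(z).  Orthogonality of the X_i and of Z to Y, where only two
    summands occur, shows that X . Y = (X(f) + sum_i X_i(f) - Z(f)) bar(Y(f)).  So X . Y is
    null exactly when the elimination condition of (C4)' holds at f.

    Given orthogonality and a modular family, the complement of {z, e_1, ..., e_k} in the
    union A of the supports is a basis of A, because the height of A is its nullity; Z is
    the fundamental circuit of z, and Y extends the fundamental cocircuit of f in A.
    Conversely, given circuits satisfying (C4)' and supp X /\ supp Y = {f, z, e_1, ..., e_k},
    take a basis containing supp X \ {z, e_1, ..., e_k} and meeting supp Y only in f; the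
    X_i are fundamental circuits of the e_i, they form with X a modular family, and
    (C4)' supplies Z. *)

Require Import Defs.
From mathcomp Require Import all_boot ssralg.
From mathcomp Require Import finmap multiset boolp classical_sets fintype finset.

Set Implicit Arguments.
Unset Strict Implicit.
Unset Printing Implicit Defensive.

Local Open Scope set_scope.

(** * Circuits and cocircuits of matroids *)

Section MatroidTheory.
Variables (E : finType) (N : matroid E).
Implicit Types (A B C S U : {set E}) (x y : E).

Lemma indepP S : reflect (exists2 B, B \in bases N & S \subset B) (indep N S).
Proof.
by apply: (iffP exists_inP) => -[B ? ?]; exists B.
Qed.

Lemma indep_sub S S' : S \subset S' -> indep N S' -> indep N S.
Proof.
by move=> sS /indepP[B BN sB]; apply/indepP; exists B => //; apply: subset_trans sB.
Qed.

Lemma bases_card B B' : B \in bases N -> B' \in bases N -> #|B| = #|B'|.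
Proof. by move=> BN B'N; apply/eqP; rewrite eqn_leq !(@bases_leq E N). Qed.

Lemma circuitP C :
  reflect (~~ indep N C /\ forall S, S \subset C -> ~~ indep N S -> S = C)
          (C \in circuits N).
Proof.
rewrite inE; apply: (iffP minsetP) => -[dC minC]; split=> // S.
  by move=> sS dS; apply: minC.
by move=> dS sS; apply: minC.
Qed.

Lemma circuit_subset C C' :
  C \in circuits N -> C' \in circuits N -> C \subset C' -> C = C'.
Proof. by move=> /circuitP[dC _] /circuitP[_ m] s; apply: m. Qed.

Lemma circuitD1_indep C x : C \in circuits N -> x \in C -> indep N (C :\ x).
Proof.
move=> /circuitP[_ m] xC; apply: contraT => dCx.
have e := m _ (subD1set C x) dCx; by move: xC; rewrite -e !inE eqxx.
Qed.

(** Among the bases containing [S], take one with the most elements in [U]. An element of it outside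
    [U] could be exchanged for one of [B0], hence of [U], without touching [S]. *)
Lemma indep_extend S U B0 : indep N S -> S \subset U -> B0 \in bases N ->
  B0 \subset U -> exists B, [/\ B \in bases N, S \subset B & B \subset U].
Proof.
move=> /indepP[B1 B1N sSB1] sSU B0N sB0U.
pose P B := (B \in bases N) && (S \subset B).
have P1 : P B1 by rewrite /P B1N.
case: (@arg_maxnP _ B1 P (fun B => #|B :&: U|) P1) => B /andP[BN sSB] maxB.
exists B; split=> //; apply/subsetP => x xB; apply/negPn/negP => xU.
have xB0 : x \notin B0 by apply: contra xU; apply: (subsetP sB0U).
have [|y] := bases_exchange (x := x) BN B0N; first by rewrite !inE xB0.
rewrite !inE => /andP[yB yB0] yN.
have PB : P (y |: B :\ x).
  rewrite /P yN /=; apply/subsetP => u uS; rewrite !inE (subsetP sSB) // andbT.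
  by rewrite (_ : u != x) ?orbT //; apply: contraNneq xU => <-; apply: (subsetP sSU).
have := maxB _ PB; apply/negP; rewrite -ltnNge; apply: proper_card.
apply/properP; split.
  apply/subsetP => u; rewrite !inE => /andP[uB uU]; rewrite uB uU !andbT.
  by rewrite (_ : u != x) ?orbT //; apply: contraNneq xU => <-.
by exists y; rewrite !inE ?eqxx ?(subsetP sB0U) // (negPf yB).
Qed.

(** For a basis [B] and [x] outside it this is the unique circuit inside [x |: B]. Describing it by
    exchanges makes the symmetry with cocircuits immediate. *)
Definition fund_circuit B x : {set E} :=
  [set y in x |: B | (x |: B) :\ y \in bases N].

Lemma fund_circuit_sub B x : fund_circuit B x \subset x |: B.
Proof. by apply/subsetP => y; rewrite inE => /andP[]. Qed.

Lemma mem_fund_circuit B x : B \in bases N -> x \notin B -> x \in fund_circuit B x.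
Proof. by move=> BN xB; rewrite !inE eqxx /= setU1K. Qed.

(** If the set were independent, [indep_extend] would put it in a basis inside [x |: B], which by
    cardinality omits exactly one [y]; but such a [y] belongs to the set. A proper subset misses
    some [y] of the set, so it lies in the basis [(x |: B) :\ y]. *)
Lemma fund_circuitP B x : B \in bases N -> x \notin B ->
  fund_circuit B x \in circuits N.
Proof.
move=> BN xB; apply/circuitP; split.
  apply/negP => /indep_extend/(_ (fund_circuit_sub B x) BN (subsetUr _ _)).
  case=> B' [B'N sB' B's].
  have [|y yxB yB'] := @subsetPn _ (x |: B) B' _.
    apply/negP => /subset_leq_card.
    by rewrite cardsU1 xB (bases_card B'N BN) ltnn.
  have : y \in fund_circuit B x.
    rewrite inE yxB /=; suff <- : B' = (x |: B) :\ y by [].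
    apply/eqP; rewrite eqEcard; apply/andP; split.
      apply/subsetP => u uB'; rewrite in_setD1 (subsetP B's) // andbT.
      by apply: contraNneq yB' => <-.
    have /eqP := cardsD1 y (x |: B).
    by rewrite yxB cardsU1 xB (bases_card BN B'N) eqn_add2l => /eqP <-.
  by move/(subsetP sB'); rewrite (negPf yB').
move=> S sS; apply: contraNeq => neS.
have [y yF yS] : exists2 y, y \in fund_circuit B x & y \notin S.
  by apply/subsetPn; apply: contra neS => sF; rewrite eqEsubset sS.
move: (yF); rewrite inE => /andP[_ yN]; apply/indepP; exists ((x |: B) :\ y) => //.
apply/subsetP => u uS; rewrite in_setD1.
rewrite (subsetP (fund_circuit_sub B x)) ?(subsetP sS) // andbT.
by apply: contraNneq yS => <-.
Qed.

Lemma fund_circuit_uniq B x C : B \in bases N -> x \notin B ->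
  C \in circuits N -> C \subset x |: B -> C = fund_circuit B x.
Proof.
move=> BN xB CN sC; apply/esym/circuit_subset => //; first exact: fund_circuitP.
apply/subsetP => y; rewrite inE => /andP[_ yN]; apply/negPn/negP => yC.
move: CN => /circuitP[/negP[]]; apply/indepP; exists ((x |: B) :\ y) => //.
apply/subsetP => u uC; rewrite in_setD1 (subsetP sC) // andbT.
by apply: contraNneq yC => <-.
Qed.

Lemma fund_circuit_exchange B x y : x \notin B -> y \in B ->
  y \in fund_circuit B x = (x |: B :\ y \in bases N).
Proof.
move=> xB yB; rewrite !inE yB orbT /=.
suff -> : (x |: B) :\ y = x |: B :\ y by [].
apply/setP => u; rewrite !inE.
by have [->|] //= := eqVneq u x; rewrite andbT; apply: contraNneq xB => ->.
Qed.

Lemma dual_basis B : (~: B \in bases (dual N)) = (B \in bases N).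
Proof. by rewrite inE setCK. Qed.

Lemma basis_dual B : (B \in bases (dual N)) = (~: B \in bases N).
Proof. by rewrite inE. Qed.

End MatroidTheory.

Section Duality.
Variables (E : finType) (N : matroid E).
Implicit Types (A B C D S U : {set E}) (x y : E).

Definition fund_cocircuit B x : {set E} := fund_circuit (dual N) (~: B) x.

Lemma fund_cocircuitP B x : B \in bases N -> x \in B ->
  fund_cocircuit B x \in circuits (dual N).
Proof. by move=> BN xB; apply: fund_circuitP; rewrite ?dual_basis // inE xB. Qed.

Lemma mem_fund_cocircuit B x : B \in bases N -> x \in B -> x \in fund_cocircuit B x.
Proof. by move=> BN xB; apply: mem_fund_circuit; rewrite ?dual_basis // inE xB. Qed.

Lemma fund_cocircuit_cap B x y : y \in fund_cocircuit B x -> y \in B -> y = x.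
Proof.
by move/(subsetP (fund_circuit_sub _ _ _)); rewrite !inE => /orP[/eqP //|/negPf->].
Qed.

(** The criterion is that of [fund_circuit_exchange] with the roles swapped: [y] is in the
    fundamental cocircuit of [x] exactly when [x] is in the fundamental circuit of [y]. *)
Lemma fund_cocircuit_exchange B x y : x \in B -> y \notin B ->
  y \in fund_cocircuit B x = (y |: B :\ x \in bases N).
Proof.
move=> xB yB; rewrite /fund_cocircuit fund_circuit_exchange ?inE ?xB ?yB //.
suff -> : ~: (x |: ~: B :\ y) = y |: B :\ x by [].
apply/setP => u; rewrite !inE negb_or negb_and !negbK.
by have [->|] //= := eqVneq u y; rewrite andbT; apply: contraNneq yB => ->.
Qed.


(** Coindependence of [S'] puts a basis inside [~: S'], and [S] extends to a basis there. *)
Lemma separating_basis S S' : indep N S -> indep (dual N) S' -> [disjoint S & S'] ->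
  exists B, [/\ B \in bases N, S \subset B & [disjoint B & S']].
Proof.
move=> iS /indepP[B0]; rewrite inE => B0N sB0 dSS'.
have [||B [BN sB sB']] := indep_extend (U := ~: S') iS _ B0N.
- by rewrite -disjoints_subset.
- by rewrite setCS.
by exists B; rewrite disjoints_subset.
Qed.

(** Separating [C :\ a] from [D :\ b] makes [C] the fundamental circuit of [a] and [D] the
    fundamental cocircuit of [b] for one and the same basis. *)
Lemma circuit_cocircuit_basis C D a b :
  C \in circuits N -> D \in circuits (dual N) -> a \in C -> b \in D ->
  C :&: D \subset [set a; b] ->
  exists B, [/\ B \in bases N, C \subset a |: B, D \subset b |: ~: B,
                a \notin B & b \in B].
Proof.
move=> CN DN aC bD sCD.
have [|B [BN sB dB]] :=
  separating_basis (circuitD1_indep CN aC) (circuitD1_indep DN bD).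
  rewrite -setI_eq0; apply/eqP/setP => u; rewrite !inE.
  apply/negP => /andP[/andP[ua uC] /andP[ub uD]].
  by move/subsetP/(_ u): sCD; rewrite !inE uC uD (negPf ua) (negPf ub) => /(_ isT).
have sC : C \subset a |: B by rewrite -subDset.
have sD : D \subset b |: ~: B.
  by rewrite -subDset -disjoints_subset disjoint_sym.
exists B; split=> //.
  apply/negP => aB; move: CN => /circuitP[/negP[]]; apply/indepP; exists B => //.
  by apply: subset_trans sC _; rewrite subUset sub1set aB /=.
apply/negPn/negP => bB; move: DN => /circuitP[/negP[]]; apply/indepP; exists (~: B).
  by rewrite inE setCK.
by apply: subset_trans sD _; rewrite subUset sub1set inE bB /=.
Qed.

(** If [a] were the only common element, [circuit_cocircuit_basis] with [b = a] would place [a] both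
    inside and outside a basis. *)
Lemma circuit_cocircuit_meet C D a :
  C \in circuits N -> D \in circuits (dual N) -> a \in C -> a \in D ->
  exists2 b, b \in C :&: D & b != a.
Proof.
move=> CN DN aC aD; have [sCD|] := boolP (C :&: D \subset [set a]).
  have [|B [_ _ _ /negPf aB]] := circuit_cocircuit_basis CN DN aC aD.
    by rewrite setUid.
  by rewrite aB.
by case/subsetPn => b bCD; rewrite inE; exists b.
Qed.

End Duality.


(** * Nullity and height *)

Section Nullity.
Variables (E : finType) (N : matroid E).
Implicit Types (A B C D S U : {set E}) (K : {set {set E}}) (x y : E).
Local Notation UC := (union_lattice (circuits N)).

Lemma union_latticeP U x : U \in UC -> x \in U ->
  exists C, [/\ C \in circuits N, x \in C & C \subset U].
Proof.
case/imsetP => K; rewrite inE => sK -> /bigcupP[C CK xC].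
by exists C; split=> //; [apply: (subsetP sK) | apply: bigcup_sup].
Qed.

Lemma bigcup_union_lattice (I : finType) (P : pred I) (F : I -> {set E}) :
  (forall i, F i \in circuits N) -> \bigcup_(i | P i) F i \in UC.
Proof.
move=> FN; apply/imsetP; exists [set F i | i in P].
  by rewrite inE; apply/subsetP => _ /imsetP[i _ ->].
by rewrite -/(cover _) cover_imset.
Qed.

(** The subtracted maximum is the rank of [S]. The next two lemmas turn the difference into the
    minimum of [#|S :\: B|] over the bases [B]. *)
Definition nullity S : nat := #|S| - \max_(B in bases N) #|S :&: B|.

Lemma nullity_le B S : B \in bases N -> nullity S <= #|S :\: B|.
Proof.
move=> BN; rewrite leq_subLR -[leqLHS](cardsID B) leq_add2r.
exact: (leq_bigmax_cond (F := fun B => #|S :&: B|)).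
Qed.

Lemma nullity_eq S : exists2 B, B \in bases N & nullity S = #|S :\: B|.
Proof.
have /set0Pn[B0 B0N] := bases_neq0 N.
rewrite /nullity.
have [|B BN ->] := eq_bigmax_cond (A := mem (bases N)) (fun B => #|S :&: B|).
  by apply/card_gt0P; exists B0.
by exists B; rewrite // -(cardsID B S) addKn.
Qed.

Lemma nullity_mono S S' : S \subset S' -> nullity S <= nullity S'.
Proof.
move=> sS; have [B BN ->] := nullity_eq S'.
by apply: leq_trans (nullity_le _ BN) _; apply/subset_leq_card/setSD.
Qed.

(** It is enough to find a basis attaining the nullity of [U] that avoids some [x] of [U :\: S]:
    this [x] is then counted for [U] but not for [S]. *)
Lemma nullity_lt S U : U \in UC -> S \proper U -> nullity S < nullity U.
Proof.
move=> UUC /properP[sSU [x xU xS]].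
have [B BN eB] := nullity_eq U.
suff [B' [B'N xB' ->]] : exists B', [/\ B' \in bases N,
    x \notin B' & nullity U = #|U :\: B'|].
  apply: leq_ltn_trans (nullity_le _ B'N) _; apply: proper_card.
  apply/properP; split; first exact: setSD.
  by exists x; rewrite !inE ?xB' ?xU // (negPf xS) andbF.
have [xB|xB] := boolP (x \in B); last by exists B.
(* Exchange [x] for an element [g] of a circuit inside [U]: then [U :\: B] loses [g] and gains [x],
   so its size stays the same. *)
have [C [CN xC sCU]] := union_latticeP UUC xU.
have [g] := circuit_cocircuit_meet CN (fund_cocircuitP BN xB) xC (mem_fund_cocircuit BN xB).
rewrite inE => /andP[gC gD] gx.
have gB : g \notin B by apply: contra gx => /(fund_cocircuit_cap gD)/eqP.
exists (g |: B :\ x); split; first by rewrite -fund_cocircuit_exchange.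
  by rewrite !inE eqxx /= orbF eq_sym.
have -> : U :\: (g |: B :\ x) = x |: (U :\: B) :\ g.
  apply/setP => u; rewrite !inE negb_or negb_and negbK.
  have [->|ux] /= := eqVneq u x; first by rewrite eq_sym gx xU.
  by rewrite andbA.
rewrite eB cardsU1 !inE xB /= andbF (cardsD1 g (U :\: B)) !inE gB.
by rewrite (subsetP sCU).
Qed.

(** By [nullity_lt], nullity is injective on a chain below [A], and it takes at most
    [(nullity A).+1] values there. *)
Lemma height_le A : height (circuits N) A <= nullity A.
Proof.
apply/bigmax_leqP => K /and5P[/subsetP KU cK _ AK /forall_inP KA].
rewrite -subn1 leq_subLR add1n -[leqRHS]card_ord.
pose f (U : {set E}) : 'I_(nullity A).+1 := inord (nullity U).
have fE U : U \in K -> f U = nullity U :> nat.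
  by move=> UK; rewrite inordK // ltnS nullity_mono // KA.
rewrite -(card_in_imset (f := f)) ?max_card // => U V UK VK /(congr1 val) /=.
rewrite !fE // => eUV.
have sub_eq U' V' : V' \in K -> U' \subset V' -> nullity U' = nullity V' -> U' = V'.
  move=> V'K sUV' eUV'; apply/eqP; move: sUV'; rewrite subEproper => /predU1P[->//|].
  by move/(nullity_lt (KU _ V'K)); rewrite eUV' ltnn.
by case/orP: (implyP (forallP (implyP (forallP cK U) UK) V) VK) => ?;
  [apply: sub_eq | apply/esym/sub_eq].
Qed.

(** The partial unions of the [F i] grow strictly because [x i] is new at step [i]; with the empty
    union they form a chain of [n.+1] sets. *)
Lemma height_ge n (F : 'I_n -> {set E}) (x : 'I_n -> E) A :
  A \in UC -> (forall i, F i \in circuits N) -> (forall i, F i \subset A) ->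
  (forall i, x i \in F i) -> (forall i j : 'I_n, j < i -> x i \notin F j) ->
  n <= height (circuits N) A.
Proof.
move=> AU FN FA xF xFn.
pose f (m : 'I_n.+1) := \bigcup_(i in [set i : 'I_n | i < m]) F i.
have fsub (m m' : 'I_n.+1) : m <= m' -> f m \subset f m'.
  move=> mm'; apply/bigcupsP => i; rewrite inE => im.
  by apply: bigcup_sup; rewrite inE; apply: leq_trans mm'.
have fA m : f m \subset A by apply/bigcupsP.
have finj : injective f.
  have fneq (m m' : 'I_n.+1) : m < m' -> f m != f m'.
    move=> mm'; have mn : m < n by apply: leq_trans mm' _; rewrite -ltnS ltn_ord.
    apply: contraTneq (xF (Ordinal mn)) => e; apply/negP => xin.
    have : x (Ordinal mn) \in f m.
      by rewrite e; apply/bigcupP; exists (Ordinal mn); rewrite // inE.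
    case/bigcupP => j; rewrite inE => jm.
    by apply/negP/xFn.
  by move=> m m' e; case: (ltngtP m m') => [/fneq|/fneq|/val_inj //]; rewrite e eqxx.
(* [A] is added because [height] admits only chains containing their top; it may coincide with the
   last partial union. *)
pose K := A |: f @: [set: 'I_n.+1].
apply: (@leq_trans #|K|.-1).
  rewrite -ltnS; apply: leq_trans (leqSpred _).
  rewrite -[leqLHS]card_ord -cardsT -(card_imset _ finj).
  by apply/subset_leq_card/subsetUr.
apply: (leq_bigmax_cond (F := fun K : {set {set E}} => #|K|.-1)); apply/and5P; split.
- apply/subsetP => U; rewrite !inE => /orP[/eqP-> //|/imsetP[m _ ->]].
  exact: bigcup_union_lattice.
- apply/forall_inP => U; rewrite !inE => UK; apply/forall_inP => V; rewrite !inE => VK.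
  case/orP: UK => [/eqP->|/imsetP[m _ ->]]; case/orP: VK => [/eqP->|/imsetP[m' _ ->]].
  + by rewrite subxx.
  + by rewrite fA orbT.
  + by rewrite fA.
  + by case/orP: (leq_total m m') => /fsub ->; rewrite ?orbT.
- rewrite !inE; apply/orP; right; apply/imsetP; exists ord0 => //.
  by apply/esym/big1 => i; rewrite inE.
- by rewrite !inE eqxx.
- apply/forall_inP => U; rewrite !inE => /orP[/eqP-> //|/imsetP[m _ ->]].
  exact: fA.
Qed.

(** An element of the circuit outside [A] would lie in [B]; exchanging it for [x] would give a basis
    missing fewer than [nullity A] elements of [A]. *)
Lemma fund_circuit_sub_nullity A B x : B \in bases N -> nullity A = #|A :\: B| ->
  x \in A :\: B -> fund_circuit N B x \subset A.
Proof.
move=> BN eB; rewrite inE => /andP[xB xA]; apply/subsetP => y yF.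
apply: contraT => yA; have yB : y \in B.
  move/(subsetP (fund_circuit_sub _ _ _)): yF; rewrite !inE.
  by case/orP => // /eqP e; rewrite e xA in yA.
move: yF; rewrite fund_circuit_exchange // => /(nullity_le A).
rewrite eB leqNgt => /negP[]; apply: proper_card; apply/properP; split.
  apply/subsetP => u; rewrite !inE negb_or negb_and negbK => /andP[/andP[_]].
  by case/orP => [/eqP->|-> //]; rewrite (negPf yA).
by exists x; rewrite !inE ?eqxx ?xB ?xA.
Qed.

(** For an optimal basis [B], the fundamental circuits of the elements of [A :\: B] lie in [A], and
    each contains an element absent from all the others. *)
Lemma nullity_height A : A \in UC -> nullity A = height (circuits N) A.
Proof.
move=> AU; apply/eqP; rewrite eqn_leq height_le andbT.
have [B BN eB] := nullity_eq A; rewrite eB.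
have xB (i : 'I_#|A :\: B|) : enum_val i \notin B.
  by have := enum_valP i; rewrite inE => /andP[].
apply: (height_ge (F := fun i => fund_circuit N B (enum_val i))
                  (x := fun i => enum_val i)) => // [i|i|i|i j ji].
- exact: fund_circuitP.
- by apply: fund_circuit_sub_nullity => //; apply: enum_valP.
- exact: mem_fund_circuit.
- apply: contraTN isT => /(subsetP (fund_circuit_sub _ _ _)).
  rewrite !inE (negPf (xB i)) orbF => /eqP/enum_val_inj e.
  by rewrite e ltnn in ji.
Qed.

(* Among the bases B with A \ B as small as possible, one that minimises B /\ W avoids W:
   for w in B /\ W, the fundamental cocircuit of w would meet A only inside W. *)
Lemma complement_in_basis A (W : {set E}) : W \subset A -> nullity A <= #|W| ->
  (forall D, D \in circuits (dual N) -> D :&: A \subset W -> [disjoint D & A]) ->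
  exists2 B, B \in bases N & A :\: B = W.
Proof.
move=> sWA nW meetW; have [B0 B0N e0] := nullity_eq A.
pose P B := (B \in bases N) && (nullity A == #|A :\: B|).
have P0 : P B0 by rewrite /P B0N -e0 eqxx.
case: (@arg_minnP _ B0 P (fun B => #|B :&: W|) P0) => B /andP[BN /eqP eB] minB.
(* Disjointness puts [W] inside [A :\: B], whose size [nullity A] is at most [#|W|]. *)
exists B => //; suff BW : [disjoint B & W].
  apply/esym/eqP; rewrite eqEcard -eB nW andbT.
  by rewrite subsetD sWA disjoint_sym.
rewrite -setI_eq0; apply/eqP/setP => w; rewrite !inE; apply/negP => /andP[wB wW].
have wA := subsetP sWA w wW.
have [|] := boolP (fund_cocircuit N B w :&: A \subset W).
  move/(meetW _ (fund_cocircuitP BN wB)); rewrite disjoint_sym => /disjointFr/(_ wA).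
  by rewrite mem_fund_cocircuit.
case/subsetPn => g; rewrite inE => /andP[gD gA] gW.
have gw : g != w by apply: contraNneq gW => ->.
have gB : g \notin B by apply: contra gw => /(fund_cocircuit_cap gD)/eqP.
move: gD; rewrite fund_cocircuit_exchange // => B'N.
have eA : A :\: (g |: B :\ w) = w |: (A :\: B) :\ g.
  apply/setP => u; rewrite !inE negb_or negb_and negbK.
  have [->|uw] /= := eqVneq u w; first by rewrite eq_sym gw wA.
  by rewrite andbA.
have : P (g |: B :\ w).
  rewrite /P B'N eB eA cardsU1 !inE wB /= andbF (cardsD1 g (A :\: B)) !inE gB gA /=.
  exact: eqxx.
move/minB; rewrite leqNgt => /negP[]; apply: proper_card; apply/properP; split.
  apply/subsetP => u; rewrite !inE => /andP[/orP[/eqP->|/andP[_ ->//]]].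
  by rewrite (negPf gW).
by exists w; rewrite !inE ?wB ?wW ?eqxx // eq_sym (negPf gw).
Qed.

(** Links two elements of a cocircuit by a circuit, so that values on the cocircuit can be compared.
    For a basis [B] making [D] the fundamental cocircuit of [a], the fundamental circuit of [b]
    contains [a] by exchange symmetry. *)
Lemma cocircuit_circuit_pair D a b : D \in circuits (dual N) ->
  a \in D -> b \in D -> b != a ->
  exists C, [/\ C \in circuits N, a \in C, b \in C & C :&: D \subset [set a; b]].
Proof.
move=> DN aD bD ba; have /indepP[B' B'N sB'] := circuitD1_indep DN aD.
pose B := ~: B'; have BN : B \in bases N by rewrite inE in B'N.
have sD : D \subset a |: ~: B by rewrite setCK -subDset.
have aB : a \in B.
  rewrite inE; apply/negP => aB'; move: DN => /circuitP[/negP[]].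
  by apply/indepP; exists B' => //; rewrite -(setD1K aD) subUset sub1set aB'.
have bB : b \notin B by rewrite inE negbK (subsetP sB') // !inE ba.
have eD : D = fund_cocircuit N B a.
  by apply: fund_circuit_uniq; rewrite // ?dual_basis // inE aB.
exists (fund_circuit N B b); split.
- exact: fund_circuitP.
- by rewrite fund_circuit_exchange // -fund_cocircuit_exchange // -eD.
- exact: mem_fund_circuit.
apply/subsetP => u; rewrite inE => /andP[/(subsetP (fund_circuit_sub _ _ _))].
move=> + /(subsetP sD); rewrite !inE.
by case: (u == a) => //=; case: (u == b) => //= ->.
Qed.

End Nullity.

(** * Arithmetic in a skew tract *)

Section GroupSemiring.
Variable G : groupType.
Implicit Types (A B : group_semiring G) (f : G -> group_semiring G).

Lemma linext0 f : linext f 0%R = 0%R.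
Proof. by rewrite /linext (enum_mset0 : enum_mset (0%R : group_semiring G) = _) big_nil. Qed.

Lemma linextD f A B : linext f (A + B)%R = (linext f A + linext f B)%R.
Proof.
rewrite /linext -big_cat; apply: perm_big; apply/allP => x _ /=.
(* Addition is the multiset sum by definition, and this component of [msetE2] gives its
   multiplicities. *)
by rewrite count_cat !count_mem_mset; apply/eqP; exact: (msetE2 A B x).1.1.1.
Qed.

Lemma linext_gsingle f (g : G) : linext f (gsingle g) = f g.
Proof. by rewrite /linext /gsingle enum_msetn big_seq1. Qed.

Lemma linext_sum f (I : Type) (r : seq I) (P : pred I) (F : I -> group_semiring G) :
  linext f (\sum_(i <- r | P i) F i)%R = (\sum_(i <- r | P i) linext f (F i))%R.
Proof. exact: (big_morph (linext f) (linextD f) (linext0 f)). Qed.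

End GroupSemiring.

Section Tract.
Variable T : skewTract.
Implicit Types (x y z : T) (g h : units T).
Local Open Scope group_scope.

Lemma tmul0l x : tzero * x = tzero :> T. Proof. by []. Qed.

Lemma tunitP x : x != tzero -> exists g, x = tunit g.
Proof. by case: x => // g _; exists g. Qed.

Lemma tmul_eq0 x y : (x * y == tzero) = (x == tzero) || (y == tzero).
Proof. by case: x => [g|]; case: y => [h|]. Qed.

Lemma tmulV x : x != tzero -> x * x^-1 = 1.
Proof. by case: x => // g _; rewrite /mul /inv /= mulgV. Qed.

Lemma tmulVl x : x != tzero -> x^-1 * x = 1.
Proof. by case: x => // g _; rewrite /mul /inv /= mulVg. Qed.

Lemma tinv_neq0 x : (x^-1 != tzero) = (x != tzero).
Proof. by case: x. Qed.

Lemma tinjM_tunit g x : ract g (tinj x) = tinj (x * tunit g).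
Proof. by case: x => [h|]; rewrite /ract /= ?linext0 ?linext_gsingle. Qed.

Lemma null_gsingle g : ~ null (gsingle g).
Proof.
move=> /(null_lact g^-1); rewrite /lact linext_gsingle mulVg; exact: null1.
Qed.

Lemma null_tinj x : null (tinj x) -> x = tzero.
Proof. by case: x => // g /null_gsingle. Qed.

(** Conjugating [1 + eps] by [g] keeps it null, so [eps_uniq] applies to the conjugate of [eps]. *)
Lemma eps_central g : eps T * g = g * eps T.
Proof.
have /(null_lact g^-1)/(null_ract g) := null_eps T.
rewrite /lact /ract !linextD !linext_gsingle mulg1 mulVg => /eps_uniq e.
by rewrite -[in RHS]e -mulgA mulVKg.
Qed.

(** Translating [1 + eps] by the inverse of [eps] shows, by uniqueness, that this inverse is [eps]
    itself. *)
Lemma epsK : eps T * eps T = 1.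
Proof.
have /(null_lact (eps T)^-1) := null_eps T.
rewrite /lact linextD !linext_gsingle mulg1 mulVg GRing.addrC => /eps_uniq e.
by rewrite -[X in X * _]e mulVg.
Qed.

Lemma toppK : involutive (@topp T).
Proof. by case=> // g; rewrite /topp /mul /= mulgA epsK mul1g. Qed.

Lemma topp0 : topp tzero = tzero :> T. Proof. by []. Qed.

Lemma topp_eq0 x : (topp x == tzero) = (x == tzero).
Proof. by case: x. Qed.

Lemma toppMl x y : topp x * y = topp (x * y).
Proof. by rewrite /topp mulgA. Qed.

Lemma toppMr x y : x * topp y = topp (x * y).
Proof.
rewrite /topp !mulgA; congr (_ * _); case: x => // g.
by rewrite /mul /= eps_central.
Qed.

(** Translating the first unit to [1] reduces the claim to uniqueness of [eps]. This turns every
    null sum of two terms into an equation. *)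
Lemma null_tinjD x y : null (tinj x + tinj y)%R -> y = topp x.
Proof.
case: x => [g|]; last by rewrite GRing.add0r topp0 => /null_tinj.
case: y => [h|]; last by rewrite GRing.addr0 => /null_gsingle.
move=> /(null_lact g^-1).
rewrite /lact linextD !linext_gsingle mulVg => /eps_uniq e.
by rewrite /topp /mul /= eps_central -e mulVKg.
Qed.

(** Right translations by [g] and by its inverse both preserve null elements. This cancels a common
    factor [bar (Y f)] later on. *)
Lemma null_sum_tunit g (I : Type) (r : seq I) (P : pred I) (F : I -> T) :
  null (\sum_(i <- r | P i) tinj (F i * tunit g)%g)%R <->
  null (\sum_(i <- r | P i) tinj (F i))%R.
Proof.
have sumE h (F' : I -> T) : (\sum_(i <- r | P i) tinj (F' i * tunit h)%g)%R =
    ract h (\sum_(i <- r | P i) tinj (F' i))%R.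
  by rewrite /ract linext_sum; apply: eq_bigr => i _; rewrite -tinjM_tunit.
split=> [|/(null_ract g)]; last by rewrite sumE.
move=> /(null_ract g^-1); rewrite -sumE.
have tgV : tunit g * tunit g^-1 = 1 by rewrite /mul /= mulgV.
by under eq_bigr do rewrite -mulgA tgV mulg1.
Qed.

Variable bar : involution T.

Lemma bar1 : bar 1 = 1. Proof. by have [] := conj_monoid bar. Qed.
Lemma barM : {morph bar : x y / x * y}. Proof. by have [] := conj_monoid bar. Qed.

Lemma bar_eq0 x : (bar x == tzero) = (x == tzero).
Proof.
by apply/eqP/eqP => [e|->]; [rewrite -(conjK bar x) e|]; rewrite conj0.
Qed.

Lemma barV x : bar x^-1 = (bar x)^-1.
Proof.
have [->|x0] := eqVneq x tzero; first by rewrite /inv /= conj0.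
rewrite -[RHS]mulg1 -bar1 -(tmulV x0) barM mulgA tmulVl ?bar_eq0 //.
by rewrite mul1g.
Qed.

End Tract.

(** * Orthogonality and cocircuits *)

Section Orthogonality.
Variables (T : skewTract) (bar : involution T) (E : finType) (N : matroid E).
Implicit Types (X Y Z : {ffun E -> T}) (C D : set {ffun E -> T}).
Local Open Scope group_scope.

Lemma memsupp X x : (x \in supp X) = (X x != tzero).
Proof. by rewrite inE. Qed.

Lemma notin_supp X x : x \notin supp X -> X x = tzero.
Proof. by rewrite memsupp negbK => /eqP. Qed.

Lemma supp_lscale (g : units T) X : supp (lscale (tunit g) X) = supp X.
Proof. by apply/setP => x; rewrite !memsupp ffunE tmul_eq0. Qed.

Lemma supp_circuit C X : supports C = circuits N -> C X -> supp X \in circuits N.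
Proof. by move=> <- CX; rewrite inE; apply/asboolP; exists X. Qed.

Lemma circuit_supp C S : supports C = circuits N -> S \in circuits N ->
  exists2 X, C X & supp X = S.
Proof. by move=> <-; rewrite inE => /asboolP. Qed.

Lemma null_tinjN (x : T) : null (tinj x + tinj (topp x))%R.
Proof.
case: x => [g|]; last by rewrite /= GRing.addr0; apply: null0.
have := null_ract g (null_eps T).
by rewrite /ract linextD !linext_gsingle mul1g.
Qed.

Lemma orthogonal_pair X Y a b : orthogonal bar X Y -> b != a ->
  supp X :&: supp Y \subset [set a; b] ->
  X b * bar (Y b) = topp (X a * bar (Y a)).
Proof.
move=> oXY ba sXY; apply: null_tinjD; move: oXY; rewrite /orthogonal.
rewrite (bigD1 a) //= (bigD1 b) //= big1 ?GRing.addr0 // => x /andP[xa xb].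
suff /eqP-> : X x * bar (Y x) == tzero by [].
rewrite tmul_eq0 bar_eq0 -[_ || _]negbK negb_or -!memsupp -in_setI.
by apply/negP => /(subsetP sXY); rewrite !inE (negPf xa) (negPf xb).
Qed.

(** Translates orthogonality with two summands into the ratios prescribed by [tcocircuits]. After
    cancelling units, one equation is the image of the other under [bar], which keeps the order of
    factors. *)
Lemma orthogonal_ratio X Y a b :
  a \in supp X -> b \in supp X -> a \in supp Y -> b \in supp Y ->
  X b * bar (Y b) = topp (X a * bar (Y a)) <->
  Y b * (Y a)^-1 = bar (topp ((X b)^-1 * X a)).
Proof.
rewrite !memsupp => Xa Xb Ya Yb.
split=> [e|e].
  rewrite -[LHS](conjK bar) barM barV; congr (bar _).
  have -> : bar (Y b) = (X b)^-1 * (X b * bar (Y b)).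
    by rewrite mulgA tmulVl ?mul1g.
  by rewrite e toppMr toppMl -!mulgA tmulV ?mulg1 // bar_eq0.
have -> : Y b = Y b * (Y a)^-1 * Y a by rewrite -mulgA tmulVl // mulg1.
by rewrite e barM (conjK bar) toppMl toppMr !mulgA tmulV ?mul1g.
Qed.

(** The value picked by [xget] comes with its own [X'], but [X'] is a left multiple of [X] because
    both have the fundamental circuit of [a] as support; the scalar cancels in the quotient. *)
Lemma qplucker_eq C B a b X : left_signature N C -> B \in bases N ->
  a \notin B -> b \in B -> C X -> a \in supp X -> b \in supp X ->
  supp X \subset a |: B -> qplucker C B (a |: B :\ b) = topp ((X b)^-1 * X a).
Proof.
move=> [_ _ C3 sC] BN aB bB CX aX bX sX; rewrite /qplucker.
have ab : a != b by apply: contraNneq aB => ->.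
case: xgetP => [t -> [F [a' [b' [X' [eB eB' CX' [aX' bX' sX']] ->]]]]|]; last first.
  (* The default [tzero] is never taken: [B :\ b], [b], [a] and [X] are witnesses. *)
  move=> /(_ (topp ((X b)^-1 * X a)))[]; exists (B :\ b), b, a, X.
  rewrite setD1K //; split=> //; split=> //.
  by rewrite setUCA setD1K.
have eb : b = a'.
  move/setP/(_ b): (eB') (bB); rewrite eB !inE => + /orP[/eqP //|bF].
  by rewrite eqxx bF !orbT /= orbF eq_sym (negPf ab).
have ea : a = b'.
  move/setP/(_ a): (eB') (aB); rewrite eB !inE negb_or => h /andP[_ /negPf aF].
  by move: h; rewrite aF eqxx !orbF => /esym/eqP.
subst a' b'.
have sX'B : supp X' \subset a |: B by rewrite eB setUCA.
have [] := C3 X X' CX CX' _.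
  by rewrite (fund_circuit_uniq BN aB (supp_circuit sC CX) sX)
     (fund_circuit_uniq BN aB (supp_circuit sC CX') sX'B).
move=> g ->; rewrite !ffunE; congr topp.
move: bX aX; rewrite !memsupp => /tunitP[h ->] /tunitP[h' ->].
by rewrite /inv /mul /= invgM -mulgA mulKg.
Qed.

(** A basis for which [supp X] is the fundamental circuit of [a] and [supp Y] the fundamental
    cocircuit of [b] makes the ratio condition on [Y] read off [X]. *)
Lemma tcocircuit_pair C X Y a b : left_signature N C -> C X ->
  tcocircuits bar N C Y -> a \in supp X -> a \in supp Y ->
  supp X :&: supp Y \subset [set a; b] ->
  X b * bar (Y b) = topp (X a * bar (Y a)).
Proof.
move=> sigC CX [YN Yr] aX aY sXY; have [_ _ _ sC] := sigC.
have XN := supp_circuit sC CX.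
have [b'] := circuit_cocircuit_meet XN YN aX aY.
move=> b'XY b'a; move: (subsetP sXY b' b'XY) (b'XY) (b'a); rewrite !inE orbC.
case/orP => /eqP->; last by rewrite eqxx.
rewrite -!memsupp => /andP[bX bY] ba.
have [B [BN sX sY aB bB]] := circuit_cocircuit_basis XN YN aX bY sXY.
apply/orthogonal_ratio => //.
(* With this [F], the sets [a |: F] and [b |: F] are the complements of the bases [B] and
   [a |: B :\ b]. *)
pose F := ~: B :\ a.
have eF : a |: F = ~: B by rewrite setD1K // inE.
have eF' : b |: F = ~: (a |: B :\ b).
  apply/setP => u; rewrite !inE negb_or negb_and negbK.
  have [->|ub] /= := eqVneq u b; first by rewrite ba.
  by [].
have B'N : a |: B :\ b \in bases N.
  rewrite -fund_circuit_exchange // -(fund_circuit_uniq BN aB XN sX) //.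
rewrite (Yr F) //.
- rewrite /qplucker_dual eF eF' !setCK toppK (qplucker_eq sigC BN aB bB CX) //.
- by rewrite setUCA eF.
- rewrite inE /= eF eF' !basis_dual !setCK BN B'N /=.
  suff -> : ~: B :\: ~: (a |: B :\ b) = [set a] by rewrite cards1.
  apply/setP => u; rewrite !inE negbK.
  by have [->|ua] //= := eqVneq u a; case: (u \in B); rewrite ?andbF.
Qed.

(** Each ratio condition on [Y] comes from orthogonality to the fundamental circuit of [a] for the
    basis [~: (a |: F)], which meets [Y] only in [a] and [b]. *)
Lemma dual_pair_tcocircuit C D Y : dual_pair bar N C D -> D Y ->
  tcocircuits bar N C Y.
Proof.
move=> [sigC [_ _ _ sD] oCD] DY; have [_ _ _ sC] := sigC.
split=> [|F a b aY bY sY]; first by rewrite -sD inE; apply/asboolP; exists Y.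
rewrite inE /= => /and3P[aFN bFN /eqP card1].
have abF : a \notin b |: F.
  apply/negP => aF; move: card1; rewrite (_ : _ :\: _ = set0) ?cards0 //.
  by apply/eqP; rewrite setD_eq0 subUset sub1set aF subsetUr.
have [aF ba] : a \notin F /\ b != a.
  by move: abF; rewrite !inE negb_or eq_sym => /andP[].
(* Otherwise the two dual bases [a |: F] and [b |: F] would differ in size. *)
have bF : b \notin F.
  move: (bases_card (N := dual N) aFN bFN); rewrite !cardsU1 aF => /eqP; rewrite eqn_add2r.
  by case: (b \in F).
pose B := ~: (a |: F).
have BN : B \in bases N by rewrite -basis_dual.
have aB : a \notin B by rewrite !inE eqxx.
have bB : b \in B by rewrite !inE negb_or ba.
have eB' : ~: (b |: F) = a |: B :\ b.
  apply/setP => u; rewrite !inE !negb_or.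
  have [->|ub] //= := eqVneq u b; first by rewrite (negPf ba).
  by have [->|ua] := eqVneq u a.
have bC : b \in fund_circuit N B a.
  by rewrite fund_circuit_exchange // -eB' -basis_dual.
have aC := mem_fund_circuit BN aB.
have [X CX eX] := circuit_supp sC (fund_circuitP BN aB).
have sX : supp X \subset a |: B by rewrite eX fund_circuit_sub.
rewrite /qplucker_dual toppK eB' (qplucker_eq sigC BN aB bB CX) ?eX //; last by rewrite -eX.
apply/orthogonal_ratio; rewrite ?eX //.
apply: orthogonal_pair => //; first exact: oCD.
apply/subsetP => u; rewrite inE => /andP[/(subsetP sX) uB /(subsetP sY)].
move: uB; rewrite !inE negb_or.
by case: (u == a) => //=; case: (u == b) => //= /negPf->.
Qed.

(** Some [Y0] in [D] has the support of [Y]. Circuits meeting this support in exactly two elements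
    force equal ratios on [Y] and [Y0], so [Y] is a right multiple of [Y0]. *)
Lemma tcocircuit_dual_pair C D Y : dual_pair bar N C D -> tcocircuits bar N C Y ->
  D Y.
Proof.
move=> dCD cY; have [sigC [_ D2 _ sD] oCD] := dCD.
have [_ _ _ sC] := sigC; have [YN _] := cY.
have [Y0 DY0 eY0] : exists2 Y0, D Y0 & supp Y0 = supp Y.
  by move: YN; rewrite -sD inE => /asboolP.
have cY0 := dual_pair_tcocircuit dCD DY0.
have [a aY] : exists a, a \in supp Y.
  apply/set0Pn; apply: contraTneq YN => ->; apply/negP => /circuitP[/negP[]].
  have /set0Pn[B0 B0N] := bases_neq0 (dual N).
  by apply/indepP; exists B0; rewrite ?sub0set.
have aY0 : a \in supp Y0 by rewrite eY0.
have ratio b : b \in supp Y -> Y b * (Y a)^-1 = Y0 b * (Y0 a)^-1.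
  move=> bY; have bY0 : b \in supp Y0 by rewrite eY0.
  have [->|ba] := eqVneq b a; first by rewrite !tmulV // -memsupp.
  have [S [SN aS bS sSY]] := cocircuit_circuit_pair YN aY bY ba.
  have [X CX eX] := circuit_supp sC SN; rewrite -eX in aS bS sSY.
  have /(orthogonal_ratio aS bS aY bY) -> := tcocircuit_pair sigC CX cY aS aY sSY.
  rewrite -eY0 in sSY.
  by have /(orthogonal_ratio aS bS aY0 bY0) -> := tcocircuit_pair sigC CX cY0 aS aY0 sSY.
have : (Y0 a)^-1 * Y a != tzero.
  by rewrite tmul_eq0 negb_or tinv_neq0 -!memsupp aY0.
case/tunitP => g eg.
suff -> : Y = rscale Y0 (tunit g) by apply: D2.
apply/ffunP => b; rewrite ffunE -eg mulgA.
have [bY|bY] := boolP (b \in supp Y).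
  by rewrite -ratio // -mulgA tmulVl ?mulg1 // -memsupp.
by rewrite [Y0 b]notin_supp ?eY0 // !tmul0l notin_supp.
Qed.

Lemma orthogonal_elimination k (Xs : 'I_k -> {ffun E -> T}) (e : 'I_k -> E) X Y Z f z :
  f \in supp Y -> supp X :&: supp Y \subset f |: (z |: e @: [set: 'I_k]) ->
  f != z -> injective e -> (forall i, e i != f) -> (forall i, e i != z) ->
  (forall i, X (e i) = topp (Xs i (e i))) ->
  (forall i, Xs i f * bar (Y f) = topp (Xs i (e i) * bar (Y (e i)))) ->
  X z = Z z -> Z f * bar (Y f) = topp (Z z * bar (Y z)) ->
  orthogonal bar X Y <->
  null (tinj (X f) + \sum_(i < k) tinj (Xs i f) + tinj (topp (Z f)))%R.
Proof.
move=> fY sXY fz inje ef ez eX eXs eXZ eZ.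
have /tunitP[g eg] : bar (Y f) != tzero by rewrite bar_eq0 -memsupp.
(* Gathering the terms in one list lets [null_sum_tunit] multiply all of them by [bar (Y f)]. *)
pose s := [:: X f, topp (Z f) & [seq Xs i f | i : 'I_k]].
have -> : (tinj (X f) + \sum_(i < k) tinj (Xs i f) + tinj (topp (Z f)))%R =
    (\sum_(x <- s) tinj x)%R.
  by rewrite !big_cons big_map big_enum /= -GRing.addrA [(\sum_(_ < _) _ + _)%R]GRing.addrC.
rewrite -(null_sum_tunit g) !big_cons big_map big_enum /= /orthogonal.
suff -> : (\sum_(x : E) tinj (X x * bar (Y x))%g)%R =
   (\sum_(x in f |: (z |: e @: [set: 'I_k])) tinj (X x * bar (Y x))%g)%R.
  rewrite !big_setU1 /=; last 2 first.
  - by apply/imsetP => -[i _ /eqP]; rewrite eq_sym (negPf (ez i)).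
  - rewrite !inE negb_or fz; apply/imsetP => -[i _ /eqP].
    by rewrite eq_sym (negPf (ef i)).
  rewrite big_imset /=; last by move=> ? ? _ _; apply: inje.
  (* The sums now agree term by term: [Z] at [f] accounts for [X] at [z], and [Xs i] at [f] for [X]
     at [e i]. *)
  rewrite -eg toppMl eZ toppK -eXZ.
  under [in X in _ <-> X]eq_bigr do rewrite eXs -toppMl -eX.
  by rewrite (eq_bigl predT) // => i; rewrite inE.
rewrite [RHS]big_mkcond; apply: eq_bigr => x _; case: ifPn => // xW.
suff /eqP-> : X x * bar (Y x) == tzero by [].
rewrite tmul_eq0 bar_eq0 -[_ || _]negbK negb_or -!memsupp -in_setI.
by apply: contra xW; apply: (subsetP sXY).
Qed.

End Orthogonality.

(** * Elimination and orthogonality *)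

Section Main.
Variables (T : skewTract) (bar : involution T) (E : finType) (N : matroid E).
Implicit Types (X Y Z : {ffun E -> T}) (C D : set {ffun E -> T}).
Local Open Scope group_scope.

Lemma circuit_supp_value C S x (t : T) : left_signature N C ->
  S \in circuits N -> x \in S -> t != tzero ->
  exists X, [/\ C X, supp X = S & X x = t].
Proof.
move=> [_ C2 _ sC] SN xS t0; have [X CX eX] := circuit_supp sC SN.
have Xx : X x != tzero by rewrite -memsupp eX.
have /tunitP[g eg] : t * (X x)^-1 != tzero.
  by rewrite tmul_eq0 negb_or t0 tinv_neq0.
exists (lscale (tunit g) X); split; [exact: C2 | by rewrite supp_lscale|].
by rewrite ffunE -eg -mulgA tmulVl // mulg1.
Qed.

Lemma dual_pair_C4 C D : dual_pair bar N C D -> C4' C.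
Proof.
move=> [sigC [_ _ _ sD] oCD]; have [_ _ _ sC] := sigC.
move=> k Xs X e CXs CX [_]; rewrite sC card_option card_ord.
set A := (\bigcup_i _)%SET => hA nsX eP eX.
have [z zX zXs] := subsetPn nsX.
have zXsi i : z \notin supp (Xs i) by apply: contra zXs => ?; apply/bigcupP; exists i.
have eXP i : e i \in supp X by have := eP i; rewrite !inE => /and3P[].
have eXsP i : e i \in supp (Xs i) by have := eP i; rewrite !inE => /and3P[].
have eXsN i j : j != i -> e i \notin supp (Xs j).
  move=> ji; have := eP i; rewrite inE => /andP[+ _]; apply: contra => ?.
  by apply/bigcupP; exists j.
have inje : injective e.
  move=> i j eij; apply/eqP; apply: contraT => ij.
  by have := eXsN _ _ ij; rewrite -eij eXsP.
have ez i : e i != z by apply: contraNneq (zXsi i) => <-.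
have XA : supp X \subset A by apply: (bigcup_sup None).
have XsA i : supp (Xs i) \subset A by apply: (bigcup_sup (Some i)).
have AU : A \in union_lattice (circuits N).
  by apply: bigcup_union_lattice => -[i|] /=; apply: supp_circuit sC _.
pose W := z |: e @: [set: 'I_k].
have eW i : e i \in W by rewrite inE imset_f ?orbT // inE.
have WP u : u \in W -> u = z \/ exists i, u = e i.
  by rewrite !inE => /orP[/eqP->|/imsetP[i _ ->]]; [left|right; exists i].
have sWA : W \subset A.
  apply/subsetP => u /WP[->|[i ->]]; first exact: (subsetP XA).
  exact: (subsetP XA).
have cW : #|W| = k.+1.
  rewrite cardsU1 card_imset // cardsT card_ord; case: imsetP => // -[i _ ezi].
  by have := ez i; rewrite ezi eqxx.
have [||B BN eB] := complement_in_basis sWA (N := N).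
- by rewrite nullity_height // hA cW.
(* [D0] cannot meet a circuit in one element. The support of [Xs i] meets [W] only in [e i], so [D0]
   misses every [e i]; then it could meet [supp X] only in [z], so it misses [z] too. *)
- move=> D0 D0N sD0.
  have eD i : e i \notin D0.
    apply/negP => eD; have XsN := supp_circuit sC (CXs i).
    have [b] := circuit_cocircuit_meet XsN D0N (eXsP i) eD.
    rewrite inE => /andP[bX bD] bei.
    have /WP[bz|[j bj]] : b \in W by apply: (subsetP sD0); rewrite inE bD (subsetP (XsA i)).
      by rewrite bz (negPf (zXsi i)) in bX.
    move: bX; apply/negP; rewrite bj; apply: eXsN.
    by apply: contraNneq bei => ->; rewrite bj.
  have zD : z \notin D0.
    apply/negP => zD; have [b] := circuit_cocircuit_meet (supp_circuit sC CX) D0N zX zD.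
    rewrite inE => /andP[bX bD] bz.
    have /WP[/eqP|[j bj]] : b \in W by apply: (subsetP sD0); rewrite inE bD (subsetP XA).
      by rewrite (negPf bz).
    by move: bD; rewrite bj (negPf (eD j)).
  rewrite -setI_eq0; apply/eqP/setP => u; rewrite [RHS]inE; apply/negP => uDA.
  have := subsetP sD0 u uDA; move: uDA; rewrite inE => /andP[uD _].
  by case/WP => [|[i]] e'; move: uD; rewrite e' ?(negPf zD) ?(negPf (eD i)).
have WB u : u \in W -> u \notin B by rewrite -eB inE => /andP[].
have zW : z \in W by rewrite !inE eqxx.
have zB := WB z zW.
have X0 : X z != tzero by rewrite -memsupp.
have [Z [CZ sZ Zz]] :=
  circuit_supp_value sigC (fund_circuitP BN zB) (mem_fund_circuit BN zB) X0.
have ZA : supp Z \subset A.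
  rewrite sZ; apply: fund_circuit_sub_nullity => //; last by rewrite eB.
  by rewrite eB nullity_height // hA cW.
have ZzB : supp Z \subset z |: B by rewrite sZ fund_circuit_sub.
have Ze i : Z (e i) = tzero.
  apply: notin_supp; apply/negP => /(subsetP ZzB).
  by rewrite !inE (negPf (ez i)) (negPf (WB _ (eW i))).
exists Z; split=> // f.
have [fA|fA] := boolP (f \in A); last first.
  rewrite !notin_supp /= ?(contra (subsetP XA _)) ?(contra (subsetP ZA _)) //.
  rewrite big1 ?GRing.add0r => [|i _]; first exact: null0.
  by rewrite notin_supp // (contra (subsetP (XsA i) _)).
(* On [W] the surviving terms cancel in pairs: [X] against [Z] at [z], and [X] against [Xs i] at
   [e i]. *)
have [/WP[->|[i ->]]|fW] := boolP (f \in W).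
- rewrite big1 => [|i _]; last by rewrite notin_supp.
  by rewrite Zz GRing.addr0; apply: null_tinjN.
- rewrite Ze GRing.addr0 (bigD1 i) //= big1 => [|j ji]; last by rewrite notin_supp ?eXsN.
  by rewrite GRing.addr0 (eX i).1 GRing.addrC; apply: null_tinjN.
have fB : f \in B by apply: contraNT fW => fB; rewrite -eB inE fB.
have [Y DY eY] := circuit_supp sD (fund_cocircuitP BN fB).
have fY : f \in supp Y by rewrite eY mem_fund_cocircuit.
have sY : supp Y \subset f |: ~: B by rewrite eY fund_circuit_sub.
have AY u : u \in A -> u \in supp Y -> u \in f |: W.
  move=> uA /(subsetP sY); rewrite -eB !inE => /orP[->//|->].
  by rewrite uA orbT.
have fz : f != z by apply: contraNneq fW => ->.
have ef i : e i != f by apply: contraNneq fW => <-.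
apply/(orthogonal_elimination (bar := bar) (Y := Y) (z := z) (e := e)) => //.
- by apply/subsetP => u; rewrite inE => /andP[/(subsetP XA)]; apply: AY.
- by move=> i; case: (eX i).
- move=> i; apply: orthogonal_pair; [exact: oCD | by rewrite eq_sym|].
  apply/subsetP => u; rewrite inE => /andP[uX uY].
  have := AY u (subsetP (XsA i) u uX) uY; rewrite in_setU1.
  case/orP => [/eqP->|/WP[uz|[j uj]]]; first by rewrite !inE eqxx orbT.
    by rewrite uz (negPf (zXsi i)) in uX.
  have [ij|ij] := eqVneq i j; first by rewrite uj ij !inE eqxx.
  by rewrite uj (negPf (eXsN _ _ ij)) in uX.
- apply: orthogonal_pair => //; first exact: oCD.
  apply/subsetP => u; rewrite inE => /andP[/(subsetP ZzB) + /(subsetP sY)].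
  by rewrite !inE; case: (u == z) => //=; case: (u == f) => //= ->.
- exact: oCD.
Qed.

Lemma tcocircuits_orthogonal C X Y : left_signature N C -> C4' C -> C X ->
  tcocircuits bar N C Y -> orthogonal bar X Y.
Proof.
move=> sigC C4 CX cY; have [_ _ _ sC] := sigC; have [YN _] := cY.
have XN := supp_circuit sC CX.
have [XY0|[f]] := set_0Vmem (supp X :&: supp Y).
  rewrite /orthogonal big1 => [|x _]; first exact: null0.
  suff /eqP-> : X x * bar (Y x) == tzero by [].
  rewrite tmul_eq0 bar_eq0 -[_ || _]negbK negb_or -!memsupp -in_setI.
  by rewrite XY0 inE.
rewrite inE => /andP[fX fY].
have [z] := circuit_cocircuit_meet XN YN fX fY.
rewrite inE => /andP[zX zY] zf.
(* The common elements are [f], [z] and the [e i]; [f] is where the elimination relation will be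
   read. *)
pose W := (supp X :&: supp Y) :\ f.
have zW : z \in W by rewrite !inE -!memsupp zf zX.
pose k := #|W :\ z|; pose e (i : 'I_k) := enum_val i.
have eP i : [/\ e i != z, e i != f, e i \in supp X & e i \in supp Y].
  by have := enum_valP i; rewrite /W !in_setD1 inE -/(e i) => /and4P[].
have inje : injective e by apply: enum_val_inj.
have eWP u : u \in W -> u != z -> exists i, u = e i.
  move=> uW uz; have uWz : u \in W :\ z by rewrite in_setD1 uz.
  by exists (enum_rank_in uWz u); rewrite /e enum_rankK_in.
have eW i : e i \in W by have [_ ef eX eY] := eP i; rewrite in_setD1 inE ef eX.
(* This [B] meets [supp Y] only in [f] and avoids [W], so each [e i] and [z] has a fundamental
   circuit. *)
have [|||B [BN sB dB]] := @separating_basis _ N (supp X :\: W) (supp Y :\ f).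
- by apply: indep_sub (circuitD1_indep XN zX); rewrite setDS // sub1set.
- exact: circuitD1_indep.
- rewrite -setI_eq0; apply/eqP/setP => u; rewrite /W !inE.
  by case: (u == f); rewrite ?andbF //=; case: (X u == tzero); case: (Y u == tzero).
have fB : f \in B by apply: (subsetP sB); rewrite /W !inE -!memsupp eqxx fX.
have BY u : u \in B -> u \in supp Y -> u = f.
  move=> uB uY; apply/eqP; apply: contraT => uf.
  by have := disjointFr dB uB; rewrite in_setD1 uf uY.
have WB u : u \in W -> u \notin B.
  rewrite in_setD1 inE => /and3P[uf _ uY]; apply: contra uf => uB.
  by apply/eqP/BY.
have eB i := WB _ (eW i); have zB := WB _ zW.
have /choice[Xs XsP] : forall i, exists Xi, [/\ C Xi, supp Xi = fund_circuit N B (e i)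
    & Xi (e i) = topp (X (e i))].
  move=> i; apply: circuit_supp_value => //; first exact: fund_circuitP.
    exact: mem_fund_circuit.
  by rewrite topp_eq0 -memsupp; case: (eP i).
have CXs i : C (Xs i) by case: (XsP i).
have XsB i : supp (Xs i) \subset e i |: B.
  by case: (XsP i) => _ -> _; apply: fund_circuit_sub.
have eXs i : e i \in supp (Xs i).
  by case: (XsP i) => _ -> _; apply: mem_fund_circuit.
have XsN i u : u \notin B -> u != e i -> u \notin supp (Xs i).
  by move=> uB ue; apply: contra uB => /(subsetP (XsB i)); rewrite !inE (negPf ue).
have zXs i : z \notin supp (Xs i).
  by apply: XsN => //; rewrite eq_sym; case: (eP i).
have eXsN i j : j != i -> e i \notin supp (Xs j).
  by move=> ji; apply: XsN; rewrite ?eB // (inj_eq inje) eq_sym.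
have eXe i : X (e i) = topp (Xs i (e i)).
  by case: (XsP i) => _ _ ->; rewrite toppK.
pose F (o : option 'I_k) := supp (oapp Xs X o).
have FN o : F o \in circuits N by apply: supp_circuit sC _; case: o => [i|] /=.
have modF : modular_family (supports C) F.
  rewrite sC; split=> //; rewrite card_option card_ord.
  set A := (\bigcup_i _)%SET.
  have AU : A \in union_lattice (circuits N) by apply: bigcup_union_lattice.
  (* Every element of [A] outside [B] lies in [W], which bounds the height by [#|W|]. *)
  apply/eqP; rewrite eqn_leq; apply/andP; split.
    apply: leq_trans (height_le _ _) _.
    apply: leq_trans (nullity_le _ BN) _.
    have <- : #|W| = k.+1 by rewrite (cardsD1 z) zW.
    apply: subset_leq_card; rewrite subDset; apply/bigcupsP => -[i|] _.
      by apply: subset_trans (XsB i) _; rewrite setUC setUS // sub1set.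
    by rewrite /F /= setUC -subDset.
  pose x (o : option 'I_k) := oapp e z o.
  (* [unlift ord_max] places [X] last: its support contains every [e i], whereas [z] lies in no
     [Xs i]. *)
  apply: (height_ge (F := fun j : 'I_k.+1 => F (unlift ord_max j))
                    (x := fun j => x (unlift ord_max j))) => // [j|j|i j ji].
  - exact: bigcup_sup.
  - by case: unliftP => [i _|_] /=; rewrite ?eXs.
  - case: (unliftP ord_max j) => [j' ej|ej]; last first.
      by move: ji; rewrite ej ltnNge /= -ltnS ltn_ord.
    case: unliftP => [i' ei|ei] /=; last exact: zXs.
    by apply: eXsN; apply: contraTneq ji => ij; rewrite ej ei ij ltnn.
have [|||Z [CZ Ze relZ]] := C4 k Xs X e CXs CX modF.
- by apply/subsetPn; exists z => //; apply/negP => /bigcupP[i _]; apply/negP.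
- move=> i; have [_ _ eX _] := eP i.
  rewrite inE [X in _ && X]inE eX eXs !andbT; apply/negP => /bigcupP[j ji].
  exact/negP/eXsN.
- move=> i; split=> //; rewrite -eXe; apply/eqP; rewrite -memsupp.
  by case: (eP i).
(* No [Xs i] contains [z], so the relation at [z] has only two terms. *)
have Zz : Z z = X z.
  have := relZ z; rewrite big1 => [|i _]; last by rewrite notin_supp.
  by rewrite GRing.addr0 => /null_tinjD/(congr1 (@topp T)); rewrite !toppK.
have Z0 u : X u = tzero -> (forall i, Xs i u = tzero) -> Z u = tzero.
  move=> Xu Xsu; have := relZ u; rewrite Xu big1 => [|i _]; last by rewrite Xsu.
  by rewrite !GRing.add0r => /null_tinj/eqP; rewrite topp_eq0 => /eqP.
(* At any other element of [supp Y], either it is some [e i], where [Z] vanishes, or [X] and all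
   [Xs i] vanish and the relation forces [Z] to vanish. *)
have sZY : supp Z :&: supp Y \subset [set z; f].
  apply/subsetP => u; rewrite inE => /andP[uZ uY]; rewrite !inE.
  apply: contraT; rewrite negb_or => /andP[uz uf].
  have uW : u \notin W.
    by apply: contraL uZ => /eWP/(_ uz)[i ->]; rewrite memsupp negbK Ze.
  have uB : u \notin B by apply: contra uf => uB; apply/eqP/BY.
  have uX : u \notin supp X by apply: contra uW => uX; rewrite in_setD1 uf in_setI uX.
  move: uZ; rewrite memsupp Z0 ?eqxx // => [|i]; first exact: notin_supp.
  by apply/notin_supp/XsN => //; apply: contraNneq uW => ->.
apply/(orthogonal_elimination (bar := bar) (Y := Y) (z := z) (e := e) (f := f)
         (Xs := Xs) (Z := Z)) => //.
- apply/subsetP => u uXY; rewrite !inE.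
  have [->//|uf] := eqVneq u f; have [->//|uz] := eqVneq u z.
  have [||i ->] := @eWP u; rewrite // ?in_setD1 ?uf //.
  by rewrite imset_f // inE.
- by rewrite eq_sym.
- by move=> i; case: (eP i).
- by move=> i; case: (eP i).
- move=> i; have [_ ef _ eY] := eP i.
  apply: (tcocircuit_pair sigC) => //.
  apply/subsetP => u; rewrite inE => /andP[/(subsetP (XsB i)) + uY]; rewrite !inE.
  by case/orP => [->//|/BY ->]; rewrite ?eqxx ?orbT.
- apply: (tcocircuit_pair sigC) => //.
  by rewrite memsupp Zz -memsupp.
Qed.

End Main.

Theorem theorem3p17 (T : skewTract) (bar : involution T) (E : finType)
    (E_neq0 : (0 < #|E|)%N) (N : matroid E) (C D : set {ffun E -> T})
    (sigC : left_signature N C) (sigD : right_signature (dual N) D) :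
  (exists M : strongMatroid T E,
     [/\ underlying M N, C = tcircuits M & D = tcocircuits bar N (tcircuits M)])
  <-> dual_pair bar N C D.
Proof.
split=> [[M [_ eC eD]]|dCD].
  split=> // X Y CX DY; apply: (tcocircuits_orthogonal sigC) => //.
    by rewrite eC; apply: tcircuitsC4.
  by rewrite eC -eD.
have [Cz C2 C3 sC] := sigC.
exists (StrongMatroid Cz C2 C3 (dual_pair_C4 dCD)); split=> //.
apply/seteqP; split=> Y; first exact: dual_pair_tcocircuit.
exact: tcocircuit_dual_pair.
Qed.
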